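(* Let $(\mathfrak{U},\mathcal{U})$ be a measurable space, let $U$ be a random variable with values in $\mathfrak{U}$ and non-atomic law, let $f:\mathfrak{U}\to\mathbb{R}$ be measurable with $0\le f(u)\le 1$ for all $u\in\mathfrak{U}$, and let $n\ge 1$ be an integer. Let $\mathcal{B}$ and $\mathcal{C}$ be admissible partitions of $\mathfrak{U}$ (all with respect to the same $n$). If $\mathcal{C}\le_{\mathrm{ref.}}\mathcal{B}$ (that is, $\mathcal{B}$ is a refinement of $\mathcal{C}$), then $$W_{\mathrm{CI}}^{\mathcal{B}}\le_{\mathrm{cx}}W_{\mathrm{CI}}^{\mathcal{C}}.$$
   Context: Fix $n$ and let $N=\{1,\dots,n\}$. An admissible partition of $\mathfrak{U}$ is a finite sequence $\mathcal{B}=(B_1,\dots,B_b)$ of pairwise disjoint measurable sets with union $\mathfrak{U}$ such that $\mathbb{P}(U\in B_i)=k_i/n$ with $k_i\in\{1,\dots,n\}$ and $\sum_i k_i=n$. A partition $\mathcal{B}^*=(B_1^*,\dots,B_b^* )$ of $N$ is associated to $\mathcal{B}$ if $|B_i^*|=k_i$ for all $i$; each admissible $\mathcal{B}$ is taken together with an associated $\mathcal{B}^*$, and for $B=B_i\in\mathcal{B}$ one writes $B^*=B_i^*$, so that $\mathbb{P}(U\in B)=|B^*|/n$. (The laws of the estimators below do not depend on which associated partition is chosen.) $\mathcal{C}\le_{\mathrm{ref.}}\mathcal{B}$ means that every set in $\mathcal{C}$ is a union of sets in $\mathcal{B}$. For $B\in\mathcal{B}$, $P_{U|B}$ denotes the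 conditional law of $U$ given $U\in B$. Let $\{V_j^B: j\in B^*, B\in\mathcal{B}\}$ be random variables with $V_j^B$ having law $P_{U|B}$, let $\{T_j: j\in N\}$ be uniform on $[0,1]$, and let all these random variables be mutually independent. Define $$W_{\mathrm{CI}}^{\mathcal{B}}=\frac1n\sum_{B\in\mathcal{B}}\sum_{j\in B^*}I_{\{T_j\le f(V_j^B)\}},$$ where $I$ denotes the indicator, and define $W_{\mathrm{CI}}^{\mathcal{C}}$ in the same way from $\mathcal{C}$. For integrable real random variables, $Y\le_{\mathrm{cx}}X$ means $\mathbb{E}[\phi(Y)]\le\mathbb{E}[\phi(X)]$ for all convex $\phi:\mathbb{R}\to\mathbb{R}$. *)

(* Defs.v *)
From HB Require Import structures.
From mathcomp Require Import all_boot all_order all_algebra.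
From mathcomp Require Import all_classical all_reals all_analysis.
Set Implicit Arguments.
Unset Strict Implicit.
Unset Printing Implicit Defensive.
Import Order.TTheory GRing.Theory Num.Theory.
Import numFieldNormedType.Exports.

Local Open Scope classical_set_scope.
Local Open Scope ring_scope.

Definition non_atomic (d : measure_display) (T : measurableType d)
    (R : realType) (mu : set T -> \bar R) : Prop :=
  forall A : set T, measurable A -> (0 < mu A)%E ->
    exists A' : set T,
      [/\ measurable A', A' `<=` A, (0 < mu A')%E & (mu A' < mu A)%E].

Definition has_law (d d' : measure_display) (Omega : measurableType d)
    (T : measurableType d') (R : realType) (P : probability Omega R)
    (X : {mfun Omega >-> T}) (nu : set T -> \bar R) : Prop :=
  forall A : set T, measurable A -> distribution P X A = nu A.

(* The conditional law given B; only used for sets B of positive measure. *)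
Definition cond_law (T : Type) (R : realType) (mu : set T -> \bar R)
    (B A : set T) : \bar R :=
  (mu (A `&` B) / mu B)%E.

(* Mutual independence of the sigma-algebras F i. The members of the family
   may be generated by random variables with values in different spaces. *)
Definition mutually_independent (d : measure_display)
    (Omega : measurableType d) (R : realType) (P : probability Omega R)
    (I : finType) (F : I -> set (set Omega)) : Prop :=
  forall (J : {set I}) (A : I -> set Omega),
    (forall i, i \in J -> F i (A i)) ->
    P (\bigcap_(i in [set` J]) A i) = (\prod_(i in J) fine (P (A i)))%:E.

(* Y <=_cx X. The relation is between laws, so that Y and X may live on
   different probability spaces. The expectation of phi \o Y is meaningful in
   ]-oo, +oo], since a convex phi is bounded below by an affine function. *)
Definition convex_order (d1 d2 : measure_display)
    (Omega1 : measurableType d1) (Omega2 : measurableType d2) (R : realType)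
    (P1 : probability Omega1 R) (P2 : probability Omega2 R)
    (Y : Omega1 -> R) (X : Omega2 -> R) : Prop :=
  [/\ P1.-integrable setT (EFin \o Y),
      P2.-integrable setT (EFin \o X) &
      forall phi : R -> R, @convex_function R R^o setT phi ->
        ('E_P1[phi \o Y] <= 'E_P2[phi \o X])%E].

Definition admissible_partition (d : measure_display) (T : measurableType d)
    (R : realType) (mu : set T -> \bar R) (n b : nat)
    (B : 'I_b -> set T) (k : 'I_b -> nat) : Prop :=
  [/\ (forall i, measurable (B i)),
      trivIset setT B,
      \bigcup_(i in setT) B i = setT,
      (forall i, (1 <= k i <= n)%N /\ mu (B i) = ((k i)%:R / n%:R)%:E) &
      (\sum_(i < b) k i)%N = n].

Definition associated_partition (n b : nat) (k : 'I_b -> nat)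
    (Bstar : 'I_b -> {set 'I_n}) : Prop :=
  [/\ (forall i i', i != i' -> (Bstar i :&: Bstar i')%SET = finset.set0),
      (\bigcup_(i < b) Bstar i)%SET = [set: 'I_n]%SET &
      (forall i, #|Bstar i| = k i)].

(* C <=_ref B *)
Definition ref_le (T : Type) (b c : nat)
    (C : 'I_c -> set T) (B : 'I_b -> set T) : Prop :=
  forall i : 'I_c, exists J : set 'I_b, C i = \bigcup_(j in J) B j.

(* Every j lies in exactly one block of the associated partition, so the
   family V_j^B is indexed by j alone. *)
Definition CI_family (d d' : measure_display) (Omega : measurableType d)
    (T : measurableType d') (R : realType) (P : probability Omega R)
    (mu : set T -> \bar R) (n b : nat)
    (B : 'I_b -> set T) (Bstar : 'I_b -> {set 'I_n})
    (V : 'I_n -> {mfun Omega >-> T}) (Tu : 'I_n -> {mfun Omega >-> R}) : Prop :=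
  [/\ (forall i j, j \in Bstar i -> has_law P (V j) (cond_law mu (B i))),
      (forall j, has_law P (Tu j) (uniform_prob (@ltr01 R))) &
      mutually_independent P
        (fun s : 'I_n + 'I_n => match s with
           | inl j => g_sigma_algebra_preimage (V j)
           | inr j => g_sigma_algebra_preimage (Tu j)
         end)].

Definition W_CI (Omega T : Type) (R : realType) (f : T -> R) (n b : nat)
    (Bstar : 'I_b -> {set 'I_n})
    (V : 'I_n -> Omega -> T) (Tu : 'I_n -> Omega -> R) : Omega -> R :=
  fun w => n%:R^-1 *
    \sum_(i < b) \sum_(j in Bstar i) \1_[set w' | Tu j w' <= f (V j w')] w.

(* Main.v *)
Require Import Defs.
From mathcomp Require Import all_boot all_order all_algebra.
From mathcomp Require Import all_classical all_reals all_analysis.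
From mathcomp Require Import measurable_realfun ring lra.
Set Implicit Arguments.
Unset Strict Implicit.
Unset Printing Implicit Defensive.
Import Order.TTheory GRing.Theory Num.Theory.
Import numFieldNormedType.Exports.
Local Open Scope classical_set_scope.
Local Open Scope ring_scope.

(** Each summand of the estimator is the indicator of an event [T_j <= f V_j], and
    these events are independent: the pairs [(V_j, T_j)] are independent because
    all the variables are ([mutually_independent_pairs]). The event has
    probability the mean of [f] under the law of [V_j]
    ([acceptance_probability]). Hence [n] times the estimator is a sum of
    independent Bernoulli variables, whose law depends only on the list of their
    parameters, up to permutation ([expectation_W_CI]).

    The parameter of [j] is the conditional mean of [f] given the block of [j]. If
    a block of [C] is a union of blocks of [B], then both families have the same
    number of variables attached to it and the same total law
    ([sum_cond_law_blocks]); so the common parameter on the block of [C] is the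
    average of the corresponding parameters for [B].

    It remains that averaging the parameters of independent Bernoulli variables
    makes their sum larger in the convex order, a theorem of Hoeffding
    ([le_bernoulli_sum_mean_average]). For two parameters it holds because, at
    constant sum of the parameters, the mean of a convex function of the sum is a
    nondecreasing affine function of their product; the general case follows by
    finitely many two-parameter steps which bring the parameters to their
    average one at a time. *)

(** * The law of a sum of independent Bernoulli variables *)

(** The expectation of [h (X_1 + ... + X_m)] for independent Bernoulli variables
    [X_i] of parameters [ps]. Conditioning on the first variable makes it a
    recursion on [ps] in which only [h] is shifted, so that its dependence on
    any one or two parameters is visible by computation. *)
Fixpoint bernoulli_sum_mean (R : realFieldType) (h : nat -> R) (ps : seq R) : R :=
  if ps is p :: ps' then
    p * bernoulli_sum_mean (fun k => h k.+1) ps' +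
    (1 - p) * bernoulli_sum_mean h ps'
  else h 0%N.

Lemma bernoulli_sum_mean_perm (R : realFieldType) (h : nat -> R) (ps qs : seq R) :
  perm_eq ps qs -> bernoulli_sum_mean h ps = bernoulli_sum_mean h qs.
Proof.
have front p s t (g : nat -> R) :
    bernoulli_sum_mean g (s ++ p :: t) = bernoulli_sum_mean g (p :: s ++ t).
  by elim: s g => //= q s IH g; rewrite !IH /=; ring.
elim: ps qs h => [|p ps IH] qs h.
  by rewrite perm_sym => /perm_nilP ->.
move=> pq; have pqs : p \in qs by rewrite -(perm_mem pq) mem_head.
case/path.splitPr: pqs pq => s t pq.
rewrite front /=.
have : perm_eq ps (s ++ t).
  move: pq; rewrite (perm_sym _ (s ++ _)) perm_catC /= perm_cons.
  by rewrite perm_catC perm_sym.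
by move=> /[dup] /IH -> /IH ->.
Qed.

(** The mean is linear and monotone in [h], hence the second difference of [h]
    passes through it. *)
Lemma bernoulli_sum_mean_convex_ge0 (R : realFieldType) (h : nat -> R) (ps : seq R) :
  {in ps, forall p, 0 <= p <= 1} ->
  (forall k, 0 <= h k - h k.+1 *+ 2 + h k.+2) ->
  0 <= bernoulli_sum_mean h ps
       - bernoulli_sum_mean (fun k => h k.+1) ps *+ 2
       + bernoulli_sum_mean (fun k => h k.+2) ps.
Proof.
elim: ps h => [|p ps IH] h hps hh /=; first exact: hh.
have /andP[p0 p1] := hps p (mem_head _ _).
have hps' : {in ps, forall q, 0 <= q <= 1}.
  by move=> q qs; apply: hps; rewrite inE qs orbT.
have H0 := IH h hps' hh.
have H1 := IH (fun k => h k.+1) hps' (fun k => hh k.+1).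
have p1' : 0 <= 1 - p by rewrite subr_ge0.
apply: le_trans (addr_ge0 (mulr_ge0 p0 H1) (mulr_ge0 p1' H0)) _.
by rewrite le_eqVlt; apply/orP; left; apply/eqP; ring.
Qed.

(** Hoeffding's two-parameter step. With the sum of two parameters fixed, the
    mean is affine in their product, with slope the mean of the second
    difference of [h], which is nonnegative for convex [h]. Replacing
    [(p, q)] by [(r, p + q - r)] adds exactly [(r - p) * (q - r)] to the
    product. *)
Lemma bernoulli_sum_mean_transfer (R : realFieldType) (h : nat -> R)
    (p q r : R) (ps : seq R) :
  {in ps, forall p, 0 <= p <= 1} ->
  (forall k, 0 <= h k - h k.+1 *+ 2 + h k.+2) ->
  0 <= (r - p) * (q - r) ->
  bernoulli_sum_mean h [:: p, q & ps]
    <= bernoulli_sum_mean h [:: r, p + q - r & ps].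
Proof.
move=> hps hh pqr; rewrite -subr_ge0.
apply: le_trans (mulr_ge0 pqr (bernoulli_sum_mean_convex_ge0 hps hh)) _.
by rewrite le_eqVlt; apply/orP; left; apply/eqP => /=; ring.
Qed.

Lemma sum_eq_exists_lt (R : realFieldType) (I : finType) (P : pred I)
    (p q : I -> R) (i0 : I) :
  \sum_(i | P i) p i = \sum_(i | P i) q i -> P i0 -> p i0 != q i0 ->
  exists2 i, P i & p i < q i.
Proof.
move=> e Pi0 ne; have [i /andP[Pi lt]|nex] := pickP (fun i => P i && (p i < q i)).
  by exists i.
(* Otherwise all the differences p i - q i are nonnegative with sum 0. *)
have ge i : P i -> 0 <= p i - q i.
  by move=> Pi; rewrite subr_ge0 leNgt; have := nex i; rewrite Pi /= => ->.
have /eqP : \sum_(i | P i) (p i - q i) = 0 by rewrite sumrB e subrr.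
rewrite psumr_eq0// => /allP/(_ i0 (mem_index_enum _)).
by rewrite Pi0 /= subr_eq0 (negPf ne).
Qed.

(** Averaging the parameters inside each block [c i = j] increases the mean of a
    convex function of the sum. As long as some parameter differs from the
    average [r] of its block, the block contains one parameter below [r] and one
    above it; moving both so that one of them becomes equal to [r] and their sum
    is kept is an allowed two-parameter step, and one parameter fewer differs
    from its average. Finitely many steps thus suffice. *)
Lemma le_bernoulli_sum_mean_average (R : realFieldType) (I : finType) (J : eqType)
    (c : I -> J) (h : nat -> R) (p : I -> R) (r : J -> R) :
  (forall i, 0 <= p i <= 1) -> (forall j, 0 <= r j <= 1) ->
  (forall k, 0 <= h k - h k.+1 *+ 2 + h k.+2) ->
  (forall j, \sum_(i | c i == j) p i = \sum_(i | c i == j) r j) ->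
  bernoulli_sum_mean h [seq p i | i <- enum I]
    <= bernoulli_sum_mean h [seq r (c i) | i <- enum I].
Proof.
move=> p01 r01 hh.
have [m] := ubnP #|[pred i | p i != r (c i)]|.
elim: m p p01 => // m IH p p01 /ltnSE le_m bal.
have [i0 /= ne0|eq_p] := pickP [pred i | p i != r (c i)]; last first.
  rewrite le_eqVlt; apply/orP; left; apply/eqP; congr bernoulli_sum_mean.
  by apply: eq_map => i; apply/eqP/negbFE/eq_p.
have bal' : \sum_(i | c i == c i0) p i = \sum_(i | c i == c i0) r (c i).
  by rewrite bal; apply: eq_bigr => i /eqP ->.
have [i /eqP ci lti] := sum_eq_exists_lt bal' (eqxx _) ne0.
have [||j /eqP cj ltj] := sum_eq_exists_lt (i0 := i0) (esym bal').
- exact: eqxx.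
- by rewrite eq_sym.
have ij : j != i by apply: contraTneq ltj => ->; rewrite -leNgt ltW.
rewrite ci in lti; rewrite cj in ltj; set s := r (c i0) in lti ltj.
pose p' k := if k == i then s else if k == j then p i + p j - s else p k.
have p'i : p' i = s by rewrite /p' eqxx.
have p'j : p' j = p i + p j - s by rewrite /p' (negPf ij) eqxx.
have p'k k : k != i -> k != j -> p' k = p k by rewrite /p' => /negPf -> /negPf ->.
have p'01 k : 0 <= p' k <= 1.
  rewrite /p'; case: eqP => _; first exact: r01.
  case: eqP => _ //; have := p01 i; have := p01 j; have := r01 (c i0); rewrite -/s.
  by move: lti ltj => *; apply/andP; split; lra.
(* Bring i and j to the front; the other parameters are unchanged. *)
have step : bernoulli_sum_mean h [seq p k | k <- enum I]
    <= bernoulli_sum_mean h [seq p' k | k <- enum I].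
  have en : perm_eq (enum I) [:: i, j & rem j (rem i (enum I))].
    apply: perm_trans (perm_to_rem (mem_enum _ i)) _.
    rewrite perm_cons; apply: perm_to_rem.
    by rewrite mem_rem_uniq ?enum_uniq// inE ij mem_enum.
  rewrite (bernoulli_sum_mean_perm _ (perm_map p en)).
  rewrite (bernoulli_sum_mean_perm _ (perm_map p' en)) /= p'i p'j.
  have -> : map p' (rem j (rem i (enum I))) = map p (rem j (rem i (enum I))).
    apply/eq_in_map => k; rewrite mem_rem_uniq ?rem_uniq ?enum_uniq// inE.
    rewrite mem_rem_uniq ?enum_uniq// inE.
    by case/and3P => kj ki _; apply: p'k.
  apply: bernoulli_sum_mean_transfer => //.
  - by move=> x /mapP[k _ ->].
  - by rewrite mulr_ge0// subr_ge0 ltW.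
apply: le_trans step _; apply: IH => //.
- apply: leq_trans le_m; apply: proper_card; apply/properP; split.
    apply/fintype.subsetP => k; rewrite !inE /p'.
    case: (eqVneq k i) => [->|ki]; first by rewrite ci eqxx.
    by case: (eqVneq k j) => [-> _|//]; rewrite cj gt_eqF.
  exists i; first by rewrite inE ci lt_eqF.
  by rewrite inE p'i ci eqxx.
- move=> l; rewrite -bal; have [cl|cl] := eqVneq (c i0) l.
    rewrite (bigD1 i) ?ci ?cl//= (bigD1 j) ?cj ?cl ?eqxx//=.
    rewrite [RHS](bigD1 i) ?ci ?cl//= [X in _ = _ + X](bigD1 j) ?cj ?cl ?eqxx//=.
    rewrite p'i p'j !addrA; congr (_ + _); first by ring.
    by apply: eq_bigr => k /andP[/andP[_ ki] kj]; apply: p'k.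
  apply: eq_bigr => k /eqP ck; apply: p'k; apply: contra_neq cl => ek.
    by rewrite -ck ek ci.
  by rewrite -ck ek cj.
Qed.

(** * Acceptance by an independent uniform variable *)

Lemma uniform_prob01_le (R : realType) (a : R) : 0 <= a <= 1 ->
  uniform_prob (@ltr01 R) [set x | x <= a] = a%:E.
Proof.
move=> /andP[a0 a1].
have mA : measurable ([set x | x <= a] : set (measurableTypeR R)).
  by rewrite -set_itvNyc; exact: measurable_itv.
have -> : uniform_prob (@ltr01 R) [set x | x <= a]
    = (\int[uniform_prob (@ltr01 R)]_x (\1_[set x | x <= a] x)%:E)%E.
  by rewrite integral_indic// setIT.
rewrite integral_uniform//; last first.
  exact/measurable_EFinP/measurable_indic.
rewrite subr0 invr1 mul1e integral_indic//.
have -> : [set x | x <= a] `&` `[0, 1]%classic = `[0, a]%classic.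
  apply/seteqP; split => x /=; rewrite !in_itv/=.
    by move=> [-> /andP[->]].
  by move=> /andP[-> xa]; rewrite xa (le_trans xa).
rewrite [LHS]lebesgue_measure_itv/= lte_fin; case: ltP => [_|a0'].
  by rewrite sube0.
by congr EFin; apply/esym/le_anti; rewrite a0 a0'.
Qed.

Lemma measurable_subgraph d (T : measurableType d) (R : realType) (f : T -> R) :
  measurable_fun setT f ->
  measurable ([set z | z.2 <= f z.1] : set (T * measurableTypeR R)).
Proof.
move=> mf; rewrite -[X in measurable X]setTI.
apply: (measurable_fun_le measurableT) => //.
exact: measurableT_comp.
Qed.

Lemma product_uniform_subgraph d (T : measurableType d) (R : realType)
    (m : probability T R) (f : T -> R) :
  measurable_fun setT f -> (forall u, 0 <= f u <= 1) ->
  (m \x uniform_prob (@ltr01 R))%E [set z | z.2 <= f z.1] = (\int[m]_x (f x)%:E)%E.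
Proof.
move=> mf f01; rewrite /product_measure1; apply: eq_integral => x _ /=.
rewrite -(uniform_prob01_le (f01 x)); congr (uniform_prob _ _).
by apply/seteqP; split => y; rewrite /xsection/= inE.
Qed.

(** * Grouping independent variables into independent pairs *)

(** If all the [V i] and [W i] are mutually independent, the pairs
    [(V i, W i)] are mutually independent and have the product laws. This is the
    hypothesis when all the [E i] are rectangles. Arbitrary measurable sets are
    allowed for one index after the other: with the events of the other indices
    frozen, both sides are finite measures in the set at the current index, and
    two such measures on a product which agree on rectangles are equal. *)
Lemma mutually_independent_pairs d d1 d2 (Omega : measurableType d)
    (T1 : measurableType d1) (T2 : measurableType d2) (R : realType)
    (P : probability Omega R) (I : finType)
    (V : I -> {mfun Omega >-> T1}) (W : I -> {mfun Omega >-> T2}) :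
  mutually_independent P (fun s : I + I => match s with
    | inl i => g_sigma_algebra_preimage (V i)
    | inr i => g_sigma_algebra_preimage (W i)
    end) ->
  forall (J : {set I}) (E : I -> set (T1 * T2)),
  (forall i, measurable (E i)) ->
  P (\bigcap_(i in [set` J]) (fun w => (V i w, W i w)) @^-1` E i) =
  (\prod_(i in J)
    fine ((distribution P (V i) \x distribution P (W i))%E (E i)))%:E.
Proof.
move=> indep J E mE.
pose Z i w := (V i w, W i w).
pose m i : probability (T1 * T2)%type R :=
  (distribution P (V i) \x distribution P (W i))%E.
have mX i A B : measurable A -> measurable B ->
    m i (A `*` B) = (distribution P (V i) A * distribution P (W i) B)%E.
  by move=> mA mB; exact: product_measure1E.
have mfin i A : measurable A -> m i A \is a fin_num.
  by move=> mA; exact: fin_num_measure.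
have mZ i : measurable_fun setT (Z i) by exact: measurable_fun_pair.
have mZE i A : measurable A -> measurable (Z i @^-1` A).
  by move=> mA; rewrite -[X in measurable X]setTI; exact: mZ.
(* The list s holds the indices whose set need not be a rectangle. *)
suff key (s : seq I) (J' : {set I}) (E' : I -> set (T1 * T2)) : (forall i, measurable (E' i)) ->
    (forall i, i \in J' -> i \notin s -> exists AB : set T1 * set T2,
       [/\ measurable AB.1, measurable AB.2 & E' i = AB.1 `*` AB.2]) ->
    P (\bigcap_(i in [set` J']) Z i @^-1` E' i)
    = (\prod_(i in J') fine (m i (E' i)))%:E.
  by apply: (key (enum I) J E mE) => i _; rewrite mem_enum.
elim: s J' E' => [|i s IH] {mE}J {}E mE rect.
  have /choice[AB hAB] i : exists AB : set T1 * set T2, 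
      i \in J -> [/\ measurable AB.1, measurable AB.2 & E i = AB.1 `*` AB.2].
    have [iJ|_] := boolP (i \in J); last by exists (setT, setT).
    by have [AB h] := rect i iJ isT; exists AB.
  pose Q (s : I + I) := match s with
    inl i => V i @^-1` (AB i).1 | inr i => W i @^-1` (AB i).2 end.
  pose K := [set s : I + I | match s with inl i | inr i => i \in J end]%SET.
  have -> : \bigcap_(i in [set` J]) Z i @^-1` E i = \bigcap_(s in [set` K]) Q s.
    apply/seteqP; split => w /= hw.
      by move=> [] i; rewrite /= inE => iJ; have := hw i iJ;
        have [_ _ ->] := hAB i iJ => -[].
    move=> i iJ; have [_ _ ->] := hAB i iJ.
    by split; [have := hw (inl i)|have := hw (inr i)]; rewrite /= inE; apply.
  rewrite indep; last first.
    move=> [] i; rewrite inE => /hAB[m1 m2 _]; [exists (AB i).1|exists (AB i).2] => //;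
    by rewrite setTI.
  congr EFin; under eq_bigl do rewrite inE.
  rewrite big_sumType/= -big_split/=; apply: eq_bigr => i iJ.
  have [m1 m2 ->] := hAB i iJ.
  rewrite mX//= fineM//; exact: fin_num_measure.
have [iJ|iJ] := boolP (i \in J); last first.
  apply: IH => // k kJ ks; apply: rect => //; rewrite inE negb_or ks andbT.
  by apply: contraNneq iJ => <-.
pose F := \bigcap_(k in [set` J :\ i]%SET) Z k @^-1` E k.
pose c := \prod_(k in (J :\ i)%SET) fine (m k (E k)).
have c0 : 0 <= c by apply: prodr_ge0 => k _; exact: fine_ge0.
have JE : [set` J] = i |` [set` (J :\ i)%SET].
  apply/seteqP; split => k /=; rewrite in_setD1.
    by move=> kJ; have [->|ki] := eqVneq k i; [left|right].
  by move=> [->//|/andP[]].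
have mF : measurable F.
  by apply: fin_bigcap_measurable => // k _; exact: mZE.
(* The left-hand side as a measure in the set at index i. *)
pose rho := pushforward (mrestr P mF) (Z i).
have rhoE A B : measurable A -> measurable B ->
    rho (A `*` B) = (c%:E * m i (A `*` B))%E.
  move=> mA mB.
  pose E' k := if k == i then A `*` B else E k.
  have E'i : E' i = A `*` B by rewrite /E' eqxx.
  have E'k k : k != i -> E' k = E k by rewrite /E' => /negPf ->.
  have := IH J E'; rewrite JE bigcap_setU1 E'i.
  have -> : \bigcap_(k in [set` (J :\ i)%SET]) Z k @^-1` E' k = F.
    by apply: eq_bigcapr => k /=; rewrite in_setD1 => /andP[ki _]; rewrite E'k.
  rewrite /rho /pushforward /mrestr => ->.
  - rewrite (bigD1 i)//= E'i EFinM fineK; last first.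
      by apply: mfin; exact: measurableX.
    rewrite muleC; congr (_%:E * _)%E; apply: eq_big => k.
      by rewrite in_setD1 andbC.
    by move=> /andP[_ ki]; rewrite E'k.
  - move=> k; have [->|ki] := eqVneq k i; first by rewrite E'i; exact: measurableX.
    by rewrite E'k.
  - move=> k kJ ks; have [->|ki] := eqVneq k i.
      by rewrite E'i; exists (A, B).
    by rewrite E'k//; apply: rect; rewrite // inE negb_or ki.
(* Absorbing the constant into one factor turns the right-hand side into a
   product measure, which is determined by its values on rectangles. *)
pose mc := mscale (NngNum c0) (distribution P (V i)).
have e1 : (mc \x distribution P (W i))%E (E i) = rho (E i).
  apply: product_measure_unique => // A B mA mB.
  by rewrite [LHS]rhoE// mX//= /mc /mscale/= muleA.
have e2 : (mc \x distribution P (W i))%E (E i) = (c%:E * m i (E i))%E.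
  rewrite [RHS](_ : _ = mscale (NngNum c0) (m i) (E i))//.
  apply: product_measure_unique => // A B mA mB.
  transitivity (c%:E * m i (A `*` B))%E; first by [].
  by rewrite mX//= /mc /mscale/= muleA.
rewrite JE bigcap_setU1 -/F.
transitivity (rho (E i)); first by [].
rewrite -e1 e2 (bigD1 i)//= EFinM fineK ?mfin// muleC.
congr (_ * _%:E)%E; apply: eq_bigl => k.
by rewrite in_setD1 andbC.
Qed.

(** * The mean of a function of the number of events that occur *)

(** The induction on the list [s] of events still to be counted splits the domain
    according to the first of them. The domain must therefore be allowed to be
    any intersection of events of the other indices; independence is what makes
    its probability factor out. *)
Lemma integral_bernoulli_sum d (Omega : measurableType d) (R : realType)
    (P : probability Omega R) (I : finType) (F : I -> set (set Omega))
    (D : I -> set Omega) :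
  mutually_independent P F -> (forall i A, F i A -> measurable A) ->
  (forall i, F i (D i)) -> (forall i, F i (~` D i)) ->
  forall (s : seq I) (h : nat -> R) (J : {set I}) (A : I -> set Omega),
  uniq s -> (forall i, i \in J -> i \notin s) -> (forall i, i \in J -> F i (A i)) ->
  (\int[P]_(w in \bigcap_(i in [set` J]) A i)
     (h (\sum_(i <- s) (w \in D i))%N)%:E
   = P (\bigcap_(i in [set` J]) A i)
     * (bernoulli_sum_mean h [seq fine (P (D i)) | i <- s])%:E)%E.
Proof.
move=> indep mF FD FDC.
have mD i : measurable (D i) by apply: mF (FD i).
have mh (s : seq I) (h : nat -> R) :
    measurable_fun setT (fun w => h (\sum_(i <- s) (w \in D i))%N).
  elim: s h => [|i s IH] h.
    by under eq_fun do rewrite big_nil; exact: measurable_cst.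
  rewrite (_ : (fun w => _) = (fun w =>
      \1_(D i) w * h (\sum_(j <- s) (w \in D j)).+1%N +
      \1_(~` D i) w * h (\sum_(j <- s) (w \in D j))%N)%R); last first.
    apply/funext => w; rewrite big_cons !indicE in_setC.
    by case: (w \in D i); rewrite /= ?mul1r ?mul0r ?addr0 ?add0r ?add1n ?add0n.
  apply: measurable_funD; apply: measurable_funM; try exact: measurable_indic.
  - exact: (IH (fun k => h k.+1)).
  - by apply: measurable_indic; exact: measurableC.
  - exact: IH.
elim=> [|i s IH] h J A /=.
  move=> _ _ FA.
  under eq_integral do rewrite big_nil.
  rewrite integral_cst 1?muleC//.
  by apply: fin_bigcap_measurable => // i iJ; exact: mF (FA i iJ).
move=> /andP[iNs us] Js FA.
have iNJ : i \notin J by apply/negP => /Js; rewrite mem_head.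
pose A' (X : set Omega) k := if k == i then X else A k.
have A'E X : \bigcap_(k in [set` (i |: J)%SET]) A' X k
    = X `&` \bigcap_(k in [set` J]) A k.
  rewrite (_ : [set` (i |: J)%SET] = i |` [set` J]); last first.
    by apply/seteqP; split => k /=; rewrite in_setU1;
      [case/orP => [/eqP|]; [left|right] | move=> [->|->]; rewrite ?eqxx ?orbT].
  rewrite bigcap_setU1 {1}/A' eqxx; congr (_ `&` _).
  apply: eq_bigcapr => k /= kJ; rewrite /A'.
  by case: eqP kJ iNJ => // -> ->.
have FA' X : F i X -> forall k, k \in (i |: J)%SET -> F k (A' X k).
  move=> FX k; rewrite in_setU1 /A'; case: eqP => [->//|_ /= kJ]; exact: FA.
have JsU k : k \in (i |: J)%SET -> k \notin s.
  rewrite in_setU1 => /orP[/eqP ->//|/Js]; by rewrite inE negb_or => /andP[].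
have PU X : F i X -> P (X `&` \bigcap_(k in [set` J]) A k)
    = (P X * P (\bigcap_(k in [set` J]) A k))%E.
  move=> FX; rewrite -A'E indep; last exact: FA'.
  rewrite big_setU1//= EFinM {1}/A' eqxx fineK; last exact/fin_num_measure/(mF i).
  rewrite indep//; congr (_ * _%:E)%E; apply: eq_bigr => k kJ; rewrite /A'.
  by case: eqP kJ iNJ => // -> ->.
set G := \bigcap_(k in [set` J]) A k in PU A'E *.
have mG : measurable G.
  by apply: fin_bigcap_measurable => // k kJ; exact: mF (FA k kJ).
have mDC : measurable (~` D i) by exact: measurableC.
rewrite [X in (\int[P]_(w in X) _)%E](_ : G = (D i `&` G) `|` (~` D i `&` G));
  last by rewrite -setIUl setUCr setTI.
rewrite integral_setU; last 4 first.
- exact: measurableI.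
- exact: measurableI.
- by apply/measurable_EFinP/measurable_funTS; exact: mh.
- by apply/disj_setPS => w [[? _] []].
(* On D i the count of the remaining events is shifted by one. *)
have -> : (\int[P]_(w in D i `&` G) (h (\sum_(j <- i :: s) (w \in D j))%N)%:E
    = P (D i) * P G
      * (bernoulli_sum_mean (fun k => h k.+1) [seq fine (P (D j)) | j <- s])%:E)%E.
  rewrite -PU// -A'E -IH//; last exact: FA'.
  rewrite A'E; apply: eq_integral => w; rewrite inE => -[Dw _].
  by rewrite big_cons mem_set// add1n.
have -> : (\int[P]_(w in ~` D i `&` G) (h (\sum_(j <- i :: s) (w \in D j))%N)%:E
    = P (~` D i) * P G
      * (bernoulli_sum_mean h [seq fine (P (D j)) | j <- s])%:E)%E.
  rewrite -PU// -A'E -IH//; last exact: FA'.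
  rewrite A'E; apply: eq_integral => w; rewrite inE => -[Dw _].
  by rewrite big_cons memNset// add0n.
rewrite probability_setC// -(fineK (fin_num_measure P _ (mD i))).
rewrite -(fineK (fin_num_measure P _ mG)) -(EFinB 1) -!EFinM -EFinD.
by congr EFin; rewrite /=; ring.
Qed.

Lemma expectation_bernoulli_sum d (Omega : measurableType d) (R : realType)
    (P : probability Omega R) (I : finType) (F : I -> set (set Omega))
    (D : I -> set Omega) (h : nat -> R) :
  mutually_independent P F -> (forall i A, F i A -> measurable A) ->
  (forall i, F i (D i)) -> (forall i, F i (~` D i)) ->
  ('E_P[fun w => h (\sum_i (w \in D i))%N]
   = (bernoulli_sum_mean h [seq fine (P (D i)) | i <- enum I])%:E)%E.
Proof.
move=> indep mF FD FDC; rewrite unlock.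
have := integral_bernoulli_sum indep mF FD FDC (s := enum I) h
  (J := finset.set0) (A := fun=> setT).
rewrite (_ : [set` finset.set0] = set0); last first.
  by apply/seteqP; split => i //=; rewrite finset.in_set0.
rewrite bigcap_set0 probability_setT mul1e enum_uniq => <- //; first last.
- by move=> i; rewrite finset.in_set0.
- by move=> i; rewrite finset.in_set0.
by apply: eq_integral => w _; rewrite big_enum.
Qed.

Lemma joint_law_product d d1 d2 (Omega : measurableType d)
    (T1 : measurableType d1) (T2 : measurableType d2) (R : realType)
    (P : probability Omega R) (I : finType)
    (V : I -> {mfun Omega >-> T1}) (W : I -> {mfun Omega >-> T2}) :
  mutually_independent P (fun s : I + I => match s with
    | inl i => g_sigma_algebra_preimage (V i)
    | inr i => g_sigma_algebra_preimage (W i)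
    end) ->
  forall i (E : set (T1 * T2)), measurable E ->
  P ((fun w => (V i w, W i w)) @^-1` E) =
  (distribution P (V i) \x distribution P (W i))%E E.
Proof.
move=> indep i E mE.
have := mutually_independent_pairs indep [set i]%SET (fun _ => mE).
rewrite big_set1 (_ : [set` [set i]%SET] = [set i]); last first.
  by apply/seteqP; split => k /=; rewrite inE => /eqP.
rewrite bigcap_set1 => ->; apply: fineK.
pose m : probability (T1 * T2)%type R :=
  (distribution P (V i) \x distribution P (W i))%E.
exact: (fin_num_measure m).
Qed.

Lemma mutually_independent_pair_preimages d d1 d2 (Omega : measurableType d)
    (T1 : measurableType d1) (T2 : measurableType d2) (R : realType)
    (P : probability Omega R) (I : finType)
    (V : I -> {mfun Omega >-> T1}) (W : I -> {mfun Omega >-> T2}) :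
  mutually_independent P (fun s : I + I => match s with
    | inl i => g_sigma_algebra_preimage (V i)
    | inr i => g_sigma_algebra_preimage (W i)
    end) ->
  mutually_independent P
    (fun i => g_sigma_algebra_preimage (fun w => (V i w, W i w))).
Proof.
move=> indep J A FA.
have /choice[E hE] i : exists E : set (T1 * T2), measurable E /\
    (i \in J -> A i = (fun w => (V i w, W i w)) @^-1` E).
  have [iJ|_] := boolP (i \in J); last by exists setT.
  by have [E mE <-] := FA i iJ; exists E; rewrite setTI.
transitivity (P (\bigcap_(i in [set` J]) (fun w => (V i w, W i w)) @^-1` E i)).
  by congr (P _); apply: eq_bigcapr => i /= iJ; rewrite (hE i).2.
rewrite (mutually_independent_pairs indep); last by move=> i; exact: (hE i).1.
congr EFin; apply: eq_bigr => i iJ.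
by rewrite -(joint_law_product indep) ?(hE i).2//; exact: (hE i).1.
Qed.

(** Given [V i = u], the uniform variable is at most [f u] with probability
    [f u]; integrate over the law of [V i]. *)
Lemma acceptance_probability d dT (Omega : measurableType d)
    (T : measurableType dT) (R : realType) (P : probability Omega R)
    (I : finType) (V : I -> {mfun Omega >-> T}) (Tu : I -> {mfun Omega >-> R})
    (f : T -> R) :
  mutually_independent P (fun s : I + I => match s with
    | inl i => g_sigma_algebra_preimage (V i)
    | inr i => g_sigma_algebra_preimage (Tu i)
    end) ->
  (forall i, has_law P (Tu i) (uniform_prob (@ltr01 R))) ->
  measurable_fun setT f -> (forall u, 0 <= f u <= 1) ->
  forall i, P [set w | Tu i w <= f (V i w)]
    = (\int[distribution P (V i)]_u (f u)%:E)%E.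
Proof.
move=> indep unif mf f01 i.
rewrite -(product_uniform_subgraph _ mf f01).
transitivity (P ((fun w => (V i w, Tu i w)) @^-1` [set z | z.2 <= f z.1])) => //.
rewrite (joint_law_product indep); last exact: measurable_subgraph.
apply: eq_integral => u _ /=; apply: unif.
exact: measurable_xsection (measurable_subgraph mf).
Qed.

Lemma integral_prob01 d (T : measurableType d) (R : realType)
    (P : probability T R) (f : T -> R) :
  measurable_fun setT f -> (forall u, 0 <= f u <= 1) ->
  exists2 p : R, 0 <= p <= 1 & (\int[P]_u (f u)%:E)%E = p%:E.
Proof.
move=> mf f01.
have i0 : (0 <= \int[P]_u (f u)%:E)%E.
  by apply: integral_ge0 => u _; rewrite lee_fin; case/andP: (f01 u).
have i1 : (\int[P]_u (f u)%:E <= 1)%E.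
  rewrite -(@probability_setT _ _ _ P) -[leRHS]mul1e -integral_cst//.
  apply: ge0_le_integral => //.
  - by move=> u _; rewrite lee_fin; case/andP: (f01 u).
  - exact/measurable_EFinP.
  - by move=> u _; rewrite lee_fin; case/andP: (f01 u).
have fn : (\int[P]_u (f u)%:E)%E \is a fin_num.
  by rewrite ge0_fin_numE// (le_lt_trans i1)// ltry.
exists (fine (\int[P]_u (f u)%:E)%E); last by rewrite fineK.
by rewrite -!lee_fin fineK// i0.
Qed.

(** * The estimator as a sum of independent Bernoulli variables *)

Lemma associated_partition_index (n b : nat) (k : 'I_b -> nat)
    (Bstar : 'I_b -> {set 'I_n}) : associated_partition k Bstar ->
  exists beta : 'I_n -> 'I_b, forall i j, (j \in Bstar i) = (beta j == i).
Proof.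
move=> [disj cover _].
have /choice[beta hb] j : exists i, j \in Bstar i.
  have : j \in (\bigcup_(i < b) Bstar i)%SET by rewrite cover finset.in_setT.
  by move=> /finset.bigcupP[i _]; exists i.
exists beta => i j; apply/idP/eqP => [ji|<-//].
apply/eqP/negPn/negP => /disj /setP /(_ j).
by rewrite !inE hb ji.
Qed.

Section W_CI.
Context d dT (Omega : measurableType d) (T : measurableType dT) (R : realType).
Context (P : probability Omega R) (mu : set T -> \bar R) (f : T -> R).
Context (n b : nat) (B : 'I_b -> set T) (k : 'I_b -> nat).
Context (Bstar : 'I_b -> {set 'I_n}).
Context (V : 'I_n -> {mfun Omega >-> T}) (Tu : 'I_n -> {mfun Omega >-> R}).
Context (mf : measurable_fun setT f) (f01 : forall u, 0 <= f u <= 1).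
Context (hstar : associated_partition k Bstar).
Context (hfam : CI_family P mu B Bstar V Tu).

Let D j := [set w | Tu j w <= f (V j w)].

Let W := W_CI f Bstar (fun j => V j) (fun j => Tu j).

Lemma W_CIE w : W w = n%:R^-1 * (\sum_j (w \in D j))%N%:R.
Proof.
have [beta hb] := associated_partition_index hstar.
rewrite /W /W_CI; congr (_ * _).
rewrite (eq_bigr (fun i => \sum_(j < n | beta j == i) ((w \in D j)%:R : R))).
  by rewrite natr_sum; symmetry; exact: (partition_big beta predT).
by move=> i _; apply: eq_big => j; [rewrite hb|rewrite indicE].
Qed.

Lemma measurable_acceptance j : measurable (D j).
Proof.
rewrite -[X in measurable X]setTI; apply: measurable_fun_le => //.
exact: measurableT_comp.
Qed.

Lemma integrable_W_CI : P.-integrable setT (EFin \o W).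
Proof.
apply: (@eq_integrable _ _ _ _ _ measurableT
    (fun w => (n%:R^-1)%:E * \sum_j (\1_(D j) w)%:E)%E).
  by move=> w _; rewrite sumEFin -EFinM /= W_CIE natr_sum.
apply: integrableZl => //; apply: integrable_sum => // j _.
by apply: integrable_indic => //; exact: measurable_acceptance.
Qed.

Lemma expectation_W_CI (phi : R -> R) :
  ('E_P[phi \o W] = (bernoulli_sum_mean (fun k => phi (n%:R^-1 * k%:R))
     [seq fine (\int[distribution P (V j)]_u (f u)%:E) | j <- enum 'I_n])%:E)%E.
Proof.
have [_ unif indep] := hfam.
have -> : phi \o W = (fun w => phi (n%:R^-1 * (\sum_j (w \in D j))%N%:R)).
  by apply/funext => w; rewrite /= W_CIE.
have FD j : g_sigma_algebra_preimage (fun w => (V j w, Tu j w)) (D j).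
  by exists [set z | z.2 <= f z.1]; [exact: measurable_subgraph|rewrite setTI].
rewrite (expectation_bernoulli_sum (fun k => phi (n%:R^-1 * k%:R))
  (mutually_independent_pair_preimages indep)) //.
- congr (bernoulli_sum_mean _ _)%:E; apply: eq_map => j.
  by rewrite (acceptance_probability indep).
- move=> j A [E mE <-].
  exact: (measurable_fun_pair (measurable_funPT (V j)) (measurable_funPT (Tu j))).
- move=> j; exists (~` [set z | z.2 <= f z.1]); last by rewrite setTI.
  by apply: measurableC; exact: measurable_subgraph.
Qed.

End W_CI.

(** * Laws of the variables in a block *)

(** A finite sum of laws is a measure, and integrates functions as the sum of
    the integrals. It lets two families of variables be compared through the
    sums of their laws alone. *)
Lemma sum_distribution_integral d d' (Omega : measurableType d)
    (T : measurableType d') (R : realType) (P : probability Omega R)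
    (I : Type) (V : I -> {mfun Omega >-> T}) (s : seq I) :
  exists m : {measure set T -> \bar R},
    (forall A, m A = (\sum_(i <- s) distribution P (V i) A)%E) /\
    (forall g : T -> \bar R, measurable_fun setT g -> (forall x, 0 <= g x)%E ->
      (\int[m]_x g x = \sum_(i <- s) \int[distribution P (V i)]_x g x)%E).
Proof.
elim: s => [|i s [m [mE mint]]].
  exists mzero; split => [A|g mg g0]; rewrite big_nil//.
  exact: integral_measure_zero.
exists (measure_add (distribution P (V i)) m); split => [A|g mg g0].
  by rewrite [LHS]measure_addE mE big_cons.
by rewrite ge0_integral_measure_add// mint// big_cons.
Qed.

(** Each of the [k i] variables of the block has law [mu] restricted to [B i] and
    divided by its mass [k i / n]; the factors [k i] cancel. *)
Lemma sum_cond_law_block d dT (Omega : measurableType d) (T : measurableType dT)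
    (R : realType) (P : probability Omega R) (mu : probability T R) (n b : nat)
    (B : 'I_b -> set T) (k : 'I_b -> nat) (Bstar : 'I_b -> {set 'I_n})
    (V : 'I_n -> {mfun Omega >-> T}) (Tu : 'I_n -> {mfun Omega >-> R}) i A :
  admissible_partition mu n B k -> associated_partition k Bstar ->
  CI_family P mu B Bstar V Tu -> measurable A ->
  (\sum_(j in Bstar i) distribution P (V j) A = n%:R%:E * mu (A `&` B i))%E.
Proof.
move=> [mB _ _ /(_ i)[/andP[k1 kn] muB] _] [_ _ /(_ i) ki] [hV _ _] mA.
have fin := fin_num_measure mu _ (measurableI _ _ mA (mB i)).
rewrite -(fineK fin) -EFinM; set r := fine _.
have k0 : (k i)%:R != 0 :> R by rewrite pnatr_eq0 -lt0n.
have n0 : n%:R != 0 :> R by rewrite pnatr_eq0 -lt0n (leq_trans k1 kn).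
rewrite (eq_bigr (fun=> (n%:R / (k i)%:R * r)%:E)) => [|j /hV ->//].
  rewrite sumEFin sumr_const ki; congr EFin.
  by rewrite -mulr_natl; field.
rewrite /cond_law muB -(fineK fin) inver mulf_eq0 invr_eq0.
rewrite (negPf k0) (negPf n0) -EFinM; congr EFin.
by rewrite invf_div mulrC.
Qed.

(** The total law over a union of blocks depends only on that union. This is why
    a partition and its refinement can be compared. *)
Lemma sum_cond_law_blocks d dT (Omega : measurableType d)
    (T : measurableType dT) (R : realType) (P : probability Omega R)
    (mu : probability T R) (n b : nat) (B : 'I_b -> set T) (k : 'I_b -> nat)
    (Bstar : 'I_b -> {set 'I_n}) (V : 'I_n -> {mfun Omega >-> T})
    (Tu : 'I_n -> {mfun Omega >-> R}) (beta : 'I_n -> 'I_b) (Q : pred 'I_b) A :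
  admissible_partition mu n B k -> associated_partition k Bstar ->
  CI_family P mu B Bstar V Tu ->
  (forall i j, (j \in Bstar i) = (beta j == i)) -> measurable A ->
  (\sum_(j | Q (beta j)) distribution P (V j) A
   = n%:R%:E * mu (A `&` \bigcup_(i in [set i | Q i]) B i))%E.
Proof.
move=> hB hBstar hV hbeta mA.
have [mB tB _ _ _] := hB.
rewrite (partition_big beta Q)//=.
transitivity (\sum_(i | Q i) (n%:R%:E * mu (A `&` B i)))%E.
  apply: eq_bigr => i Qi; rewrite -(sum_cond_law_block i hB hBstar hV mA).
  apply: eq_bigl => j; rewrite hbeta.
  by case: eqP => [->|_]; rewrite ?Qi ?andbF.
rewrite -ge0_sume_distrr//; congr (_ * _)%E.
rewrite -measure_bigsetU_ord => [|i|].
- congr (mu _); rewrite -big_filter -bigcup_seq setI_bigcupr.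
  apply: eq_bigcupl; split => i /=; by rewrite mem_filter mem_index_enum andbT.
- exact: measurableI.
- by apply: trivIset_setIl.
Qed.

(** * Comparison of a partition with its refinement *)

Lemma admissible_block_nonempty dT (T : measurableType dT) (R : realType)
    (mu : probability T R) (n b : nat) (B : 'I_b -> set T) (k : 'I_b -> nat) i :
  admissible_partition mu n B k -> B i !=set0.
Proof.
move=> [_ _ _ /(_ i)[/andP[k1 kn] muB] _]; apply/set0P/eqP => B0.
move: muB; rewrite B0 measure0 => -[] /esym/eqP.
rewrite mulf_eq0 invr_eq0 !pnatr_eq0 !eqn0Ngt k1.
by rewrite (leq_trans k1 kn).
Qed.

(** Since the blocks of [B] are nonempty and disjoint, the set of indices given by
    the refinement relation is forced: it consists of the blocks of [B] contained
    in [C l], and each block of [B] is contained in exactly one [C l]. *)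
Lemma refinement_index dT (T : measurableType dT) (R : realType)
    (mu : probability T R) (n b c : nat) (B : 'I_b -> set T) (kB : 'I_b -> nat)
    (C : 'I_c -> set T) (kC : 'I_c -> nat) :
  admissible_partition mu n B kB -> admissible_partition mu n C kC ->
  ref_le C B ->
  exists cl : 'I_b -> 'I_c, forall l, C l = \bigcup_(i in [set i | cl i == l]) B i.
Proof.
move=> hB [_ tC coverC _ _] href.
have [_ tB _ _ _] := hB.
have subC l i u : B i u -> C l u -> B i `<=` C l.
  move=> Biu; have [J ->] := href l => -[j Jj Bju].
  have <- : j = i by apply: (tB j i I I); exists u.
  by move=> v Bjv; exists j.
have /choice[cl hcl] i : exists l, B i `<=` C l.
  have [u Biu] := admissible_block_nonempty i hB.
  have : (\bigcup_(l in setT) C l) u by rewrite coverC.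
  by move=> [l _ Clu]; exists l; exact: subC Biu Clu.
exists cl => l; apply/seteqP; split => u; last by move=> [i /= /eqP <-]; exact: hcl.
move=> Clu; have [J CJ] := href l.
have := Clu; rewrite {1}CJ => -[i Ji Biu]; exists i => //=; apply/eqP.
by apply: (tC _ _ I I); exists u; split => //; exact: hcl Biu.
Qed.

Lemma convex_function_second_difference (R : realType) (phi : R -> R) (x h : R) :
  @convex_function R R^o setT phi ->
  0 <= phi x - phi (x + h) *+ 2 + phi (x + h *+ 2).
Proof.
have h0 : 0 <= (2^-1 : R) by rewrite invr_ge0 ler0n.
have h1 : (2^-1 : R) <= 1 by rewrite invf_le1 ?ler1n// ltr0n.
pose t : {i01 R} := Itv01 h0 h1.
move=> /(_ t x (x + h *+ 2)); rewrite !inE => /(_ I I).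
rewrite [X in phi X <= _](_ : _ = x + h); last first.
  transitivity (2^-1 * x + (1 - 2^-1) * (x + h *+ 2)); first by [].
  by field.
rewrite convRE /unstable.onem /= => mid.
by lra.
Qed.

Lemma count_mem_map (I : finType) (J : eqType) (g : I -> J) (x : J) :
  count_mem x [seq g i | i <- enum I] = #|[pred i | g i == x]|.
Proof.
by rewrite count_map enumT cardE -size_filter; congr size; apply: eq_filter.
Qed.

Theorem theorem4p3 (R : realType)
  (d0 : measure_display) (Omega0 : measurableType d0) (P0 : probability Omega0 R)
  (dU : measure_display) (UU : measurableType dU)
  (U : {mfun Omega0 >-> UU})
  (hU : non_atomic (distribution P0 U))
  (f : UU -> R) (mf : measurable_fun setT f)
  (hf : forall u, 0 <= f u <= 1)
  (n : nat) (hn : (1 <= n)%N)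
  (b : nat) (B : 'I_b -> set UU) (kB : 'I_b -> nat)
  (Bstar : 'I_b -> {set 'I_n})
  (hB : admissible_partition (distribution P0 U) n B kB)
  (hBstar : associated_partition kB Bstar)
  (c : nat) (C : 'I_c -> set UU) (kC : 'I_c -> nat)
  (Cstar : 'I_c -> {set 'I_n})
  (hC : admissible_partition (distribution P0 U) n C kC)
  (hCstar : associated_partition kC Cstar)
  (dB : measure_display) (OmegaB : measurableType dB) (PB : probability OmegaB R)
  (VB : 'I_n -> {mfun OmegaB >-> UU}) (TB : 'I_n -> {mfun OmegaB >-> R})
  (hVB : CI_family PB (distribution P0 U) B Bstar VB TB)
  (dC : measure_display) (OmegaC : measurableType dC) (PC : probability OmegaC R)
  (VC : 'I_n -> {mfun OmegaC >-> UU}) (TC : 'I_n -> {mfun OmegaC >-> R})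
  (hVC : CI_family PC (distribution P0 U) C Cstar VC TC)
  (href : ref_le C B) :
  convex_order PB PC
    (W_CI f Bstar (fun j => VB j) (fun j => TB j))
    (W_CI f Cstar (fun j => VC j) (fun j => TC j)).
Proof.
have [beta hbeta] := associated_partition_index hBstar.
have [gamma hgamma] := associated_partition_index hCstar.
have [cl hcl] := refinement_index hB hC href.
(* The block of C into which the variable j of the B-family falls. *)
pose delta j := cl (beta j).
have laws l A : measurable A ->
    (\sum_(j | delta j == l) distribution PB (VB j) A
     = \sum_(j | gamma j == l) distribution PC (VC j) A)%E.
  move=> mA.
  have := sum_cond_law_blocks (fun i => cl i == l) hB hBstar hVB hbeta mA.
  have := sum_cond_law_blocks (pred1 l) hC hCstar hVC hgamma mA.
  rewrite -hcl; have -> : \bigcup_(i in [set i | pred1 l i]) C i = C l.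
    apply/seteqP; split => [u [i /= /eqP ->//]|u Cu].
    by exists l => //=.
  by move=> -> ->.
(* Evaluate the equality of total laws at the whole space. *)
have sizes l : #|[pred j | delta j == l]| = #|[pred j | gamma j == l]|.
  have := laws l setT measurableT.
  under eq_bigr do rewrite probability_setT.
  under [RHS]eq_bigr do rewrite probability_setT.
  rewrite !sumEFin !sumr_const => -[] /eqP.
  by rewrite eqr_nat => /eqP.
have /choice[p hp] j : exists p : R, 0 <= p <= 1 /\
    (\int[distribution PB (VB j)]_u (f u)%:E)%E = p%:E.
  by have [p p01 ep] := integral_prob01 (distribution PB (VB j)) mf hf; exists p.
have /choice[q hq] j : exists q : R, 0 <= q <= 1 /\
    (\int[distribution PC (VC j)]_u (f u)%:E)%E = q%:E.
  by have [q q01 eq] := integral_prob01 (distribution PC (VC j)) mf hf; exists q.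
have mfE : measurable_fun setT (EFin \o f) by exact/measurable_EFinP.
have f0 u : (0 <= (f u)%:E)%E by rewrite lee_fin; case/andP: (hf u).
(* Integrate f against the equal total laws. *)
have means l : \sum_(j | delta j == l) p j = \sum_(j | gamma j == l) q j.
  have [mB [mBE mBint]] := sum_distribution_integral PB VB
    [seq j <- index_enum 'I_n | delta j == l].
  have [mC [mCE mCint]] := sum_distribution_integral PC VC
    [seq j <- index_enum 'I_n | gamma j == l].
  have : (\int[mB]_u (f u)%:E = \int[mC]_u (f u)%:E)%E.
    apply: eq_measure_integral => A mA _.
    by rewrite mBE mCE !big_filter; exact: laws.
  rewrite mBint// mCint// !big_filter.
  under eq_bigr => j _ do rewrite (hp j).2.
  under [RHS]eq_bigr => j _ do rewrite (hq j).2.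
  by rewrite !sumEFin => -[].
have /choice[g hg] l : exists j, gamma j = l.
  have [_ _ _ /(_ l)[/andP[kl _] _] _] := hC.
  have [_ _ /(_ l) card_l] := hCstar.
  have /card_gt0P[j] : (0 < #|Cstar l|)%N by rewrite card_l.
  by rewrite hgamma => /eqP; exists j.
(* g picks a representative of each block: q is constant on blocks of C. *)
pose r l := q (g l).
have qr j : q j = r (gamma j).
  apply: EFin_inj; rewrite -(hq j).2 -(hq (g (gamma j))).2.
  apply: eq_measure_integral => A mA _.
  have [hV _ _] := hVC.
  transitivity (cond_law (distribution P0 U) (C (gamma j)) A).
    by apply: hV => //; rewrite hgamma.
  by apply/esym/hV => //; rewrite hgamma hg.
split=> [||phi cvx].
- exact: (integrable_W_CI _ _ _ mf hBstar).
- exact: (integrable_W_CI _ _ _ mf hCstar).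
rewrite (expectation_W_CI mf hf hBstar hVB) (expectation_W_CI mf hf hCstar hVC).
rewrite lee_fin.
under eq_map => j do rewrite (hp j).2 /=.
under [X in _ <= bernoulli_sum_mean _ X]eq_map => j do rewrite (hq j).2 /= qr.
set h := fun k : nat => _.
(* delta and gamma take each value equally often, so the parameters of the
   C-family can be listed along the blocks seen by the B-family. *)
have -> : bernoulli_sum_mean h [seq r (gamma j) | j <- enum 'I_n]
    = bernoulli_sum_mean h [seq r (delta j) | j <- enum 'I_n].
  apply: bernoulli_sum_mean_perm.
  rewrite (map_comp r gamma) (map_comp r delta); apply: perm_map.
  by apply/allP => l _ /=; rewrite !count_mem_map sizes.
apply: le_bernoulli_sum_mean_average.
- by move=> j; exact: (hp j).1.
- by move=> l; exact: (hq (g l)).1.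
- move=> k; have := convex_function_second_difference (n%:R^-1 * k%:R) n%:R^-1 cvx.
  by rewrite /h -!natr1 !mulrDr !mulr1 mulr2n !addrA.
- move=> l; rewrite means sumr_const sizes -sumr_const.
  by apply: eq_bigr => j /eqP <-; rewrite qr.
Qed.
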